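(* Let $A$ be a commutative ring and let $i\ge j\ge 1$ be integers with $\gcd(i,j)=1$. Let $A[s,t]$ be the polynomial ring in two indeterminates $s,t$ over $A$, and let $f:\{0,1,2,\dots\}\to A[s,t]$ be defined by $f(0)=0$, $f(1)=1$ and $f(n)=t f(n-1)+s f(n-2)$ for $n\ge 2$. Then $R(A;i,j,1,1)\cong M_2(A[s,t]/I)$, where $$I=\left(f(i+j),\ f(i+j-1)-s^{j-1},\ s^{i-j}-(-1)^{i-j}\right).$$
   Context: All rings are associative and unital, and all homomorphisms are unital. For a commutative ring $A$ and positive integers $i,j$, $R(A;i,j,1,1)$ denotes the quotient of the free (noncommutative) $A$-algebra $A\langle x,y\rangle$ by the two-sided ideal generated by $x^iy+yx^j-1$ and $y^2$. The isomorphism is one of $A$-algebras. *)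

(* Defs.v *)
From HB Require Import structures.
From mathcomp Require Import all_boot all_order all_algebra.
From mathcomp Require Import finmap boolp.
From mathcomp.multinomials Require Import monalg.

Set Implicit Arguments.
Unset Strict Implicit.
Unset Printing Implicit Defensive.

Import GRing.Theory.

Local Open Scope ring_scope.
Local Open Scope quotient_scope.

(* Rings may be zero here, as may the quotients below. The library makes     *)
(* [{malg A[M]}] a ring only for nonzero [A], and its [algType] excludes the   *)
(* zero ring, so the product of [monalg.v] is put on an alias for any          *)
(* [pzRingType], and the structure of [A]-algebra is recorded by the ring      *)
(* morphism from [A]: [monalgC] for [monalg A M], [quotC] for its quotients.   *)
Definition monalg (A : pzRingType) (M : monomType) : Type := {malg A[M]}.

Section MonoidAlgebra.
Variables (A : pzRingType) (M : monomType).

HB.instance Definition _ := GRing.Zmodule.copy (monalg A M) {malg A[M]}.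

Implicit Types (g : {malg A[M]}) (k : M).
Local Notation mone := (@one M : M).

Definition monalg_one : {malg A[M]} := << 1 *g mone >>.

Definition monalg_mul g1 g2 : {malg A[M]} :=
  \sum_(k1 <- msupp g1) \sum_(k2 <- msupp g2)
    << mcoeff k1 g1 * mcoeff k2 g2 *g mmul k1 k2 >>.

Lemma monalg_mulw (d1 d2 : {fset M}) g1 g2 :
  fsubset (msupp g1) d1 -> fsubset (msupp g2) d2 ->
  monalg_mul g1 g2 = \sum_(k1 <- d1) \sum_(k2 <- d2)
    << mcoeff k1 g1 * mcoeff k2 g2 *g mmul k1 k2 >>.
Proof.
move=> le1 le2; rewrite /monalg_mul (big_fset_incl _ le1) /=.
  apply/eq_bigr=> k1 _; apply/big_fset_incl => // k _ /mcoeff_outdom ->.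
  by rewrite mulr0 monalgU0.
move=> k _ /mcoeff_outdom g1k.
by rewrite big1 => // k' _; rewrite g1k mul0r monalgU0.
Qed.

Lemma monalg_mulUU c1 c2 k1 k2 :
  monalg_mul << c1 *g k1 >> << c2 *g k2 >> = << c1 * c2 *g mmul k1 k2 >>.
Proof.
by rewrite (monalg_mulw msuppU_le msuppU_le) !big_seq_fset1 !mcoeffUU.
Qed.

Lemma monalg_mulDl : left_distributive monalg_mul +%R.
Proof.
move=> g1 g2 g.
have le1 := fsubsetUl (msupp g1) (msupp g2).
have le2 := fsubsetUr (msupp g1) (msupp g2).
rewrite (monalg_mulw (msuppD_le g1 g2) (fsubset_refl _)).
rewrite (monalg_mulw le1 (fsubset_refl _)) (monalg_mulw le2 (fsubset_refl _)).
rewrite -big_split /=; apply/eq_bigr=> k1 _.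
rewrite -big_split /=; apply/eq_bigr=> k2 _.
by rewrite mcoeffD mulrDl monalgUD.
Qed.

Lemma monalg_mulDr : right_distributive monalg_mul +%R.
Proof.
move=> g g1 g2.
have le1 := fsubsetUl (msupp g1) (msupp g2).
have le2 := fsubsetUr (msupp g1) (msupp g2).
rewrite (monalg_mulw (fsubset_refl _) (msuppD_le g1 g2)).
rewrite (monalg_mulw (fsubset_refl _) le1) (monalg_mulw (fsubset_refl _) le2).
rewrite -big_split /=; apply/eq_bigr=> k1 _.
rewrite -big_split /=; apply/eq_bigr=> k2 _.
by rewrite mcoeffD mulrDr monalgUD.
Qed.

Lemma monalg_mul0l : left_zero 0 monalg_mul.
Proof. by move=> g; rewrite /monalg_mul msupp0 big_seq_fset0. Qed.

Lemma monalg_mul0r : right_zero 0 monalg_mul.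
Proof.
by move=> g; rewrite /monalg_mul msupp0 big1 // => k _; rewrite big_seq_fset0.
Qed.

Lemma monalg_mul_suml g (r : seq M) (F : M -> {malg A[M]}) :
  monalg_mul (\sum_(k <- r) F k) g = \sum_(k <- r) monalg_mul (F k) g.
Proof.
exact: (big_morph (monalg_mul^~ g) (fun _ _ => monalg_mulDl _ _ _)
  (monalg_mul0l g)).
Qed.

Lemma monalg_mul_sumr g (r : seq M) (F : M -> {malg A[M]}) :
  monalg_mul g (\sum_(k <- r) F k) = \sum_(k <- r) monalg_mul g (F k).
Proof.
exact: (big_morph (monalg_mul g) (fun _ _ => monalg_mulDr _ _ _)
  (monalg_mul0r g)).
Qed.

Lemma monalg_mul1l : left_id monalg_one monalg_mul.
Proof.
move=> g; rewrite [in LHS](monalgE g) monalg_mul_sumr [RHS]monalgE.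
by apply/eq_bigr=> k _; rewrite monalg_mulUU mul1r mul1m.
Qed.

Lemma monalg_mul1r : right_id monalg_one monalg_mul.
Proof.
move=> g; rewrite [in LHS](monalgE g) monalg_mul_suml [RHS]monalgE.
by apply/eq_bigr=> k _; rewrite monalg_mulUU mulr1 mulm1.
Qed.

Lemma monalg_mulA : associative monalg_mul.
Proof.
move=> g1 g2 g3.
rewrite [g1]monalgE (monalg_mul_suml (monalg_mul g2 g3)).
rewrite (monalg_mul_suml g2) (monalg_mul_suml g3); apply/eq_bigr=> k1 _.
rewrite [g2]monalgE (monalg_mul_suml g3) monalg_mul_sumr.
rewrite (monalg_mul_sumr << _ *g k1 >>) (monalg_mul_suml g3).
apply/eq_bigr=> k2 _; rewrite [g3]monalgE.
rewrite (monalg_mul_sumr << _ *g k2 >>) !monalg_mul_sumr.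
by apply/eq_bigr=> k3 _; rewrite !monalg_mulUU mulrA mulmA.
Qed.

HB.instance Definition _ := GRing.Zmodule_isPzRing.Build (monalg A M)
  monalg_mulA monalg_mul1l monalg_mul1r monalg_mulDl monalg_mulDr.

Definition monalgC (c : A) : monalg A M := << c *g mone >>.
Definition monalgX (k : M) : monalg A M := << 1 *g k >>.

Lemma monalgC_is_zmod_morphism : zmod_morphism monalgC.
Proof. by move=> c1 c2; exact: monalgUB. Qed.

Lemma monalgC_is_monoid_morphism : monoid_morphism monalgC.
Proof.
split=> // c1 c2; rewrite /GRing.mul /= monalg_mulUU; congr (<< _ *g _ >>).
by rewrite mulm1.
Qed.

HB.instance Definition _ := GRing.isZmodMorphism.Build A (monalg A M)
  monalgC monalgC_is_zmod_morphism.
HB.instance Definition _ := GRing.isMonoidMorphism.Build A (monalg A M)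
  monalgC monalgC_is_monoid_morphism.

End MonoidAlgebra.

Section CommutativeMonoidAlgebra.
Variables (A : comPzRingType) (M : conomType).

Lemma monalg_mulC : commutative (@GRing.mul (monalg A M)).
Proof.
move=> g1 g2; rewrite /GRing.mul /= /monalg_mul exchange_big /=.
by apply/eq_bigr=> k2 _; apply/eq_bigr=> k1 _; rewrite mulrC mulmC.
Qed.

HB.instance Definition _ := GRing.PzRing_hasCommutativeMul.Build (monalg A M)
  monalg_mulC.

End CommutativeMonoidAlgebra.

Definition two_sided_ideal (R : pzRingType) (J : {pred R}) : Prop :=
  [/\ 0 \in J, {in J &, forall u v, u + v \in J}
    & forall a b, {in J, forall u, a * u * b \in J}].

(* Classically (boolp), the boolean predicates [J] are all the subsets of [R]. *)
Definition ideal_gen (R : pzRingType) (gs : seq R) : {pred R} :=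
  fun r => `[< forall J : {pred R},
    two_sided_ideal J -> {subset gs <= J} -> r \in J >].

Section IdealGen.
Variables (R : pzRingType) (gs : seq R).

Lemma ideal_genP r : reflect
  (forall J : {pred R}, two_sided_ideal J -> {subset gs <= J} -> r \in J)
  (r \in ideal_gen gs).
Proof. exact: asboolP. Qed.

Lemma ideal_gen_ideal : two_sided_ideal (ideal_gen gs).
Proof.
split=> [|u v /ideal_genP Ju /ideal_genP Jv|a b u /ideal_genP Ju];
  apply/ideal_genP=> J idJ sJ; have [J0 JD JM] := idJ => //.
- by apply: JD; [exact: Ju | exact: Jv].
- by apply: JM; exact: Ju.
Qed.

Lemma ideal_gen_zmod_closed : zmod_closed (ideal_gen gs).
Proof.
have [J0 JD JM] := ideal_gen_ideal; split=> // u v Ju Jv.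
by apply: JD => //; rewrite -[v]mulr1 -mulN1r mulrA; exact: JM.
Qed.

HB.instance Definition _ := GRing.isZmodClosed.Build R (ideal_gen gs)
  ideal_gen_zmod_closed.

Lemma ideal_gen_mull a u : u \in ideal_gen gs -> a * u \in ideal_gen gs.
Proof.
by move=> Ju; have [_ _ JM] := ideal_gen_ideal; rewrite -[_ * _]mulr1 JM.
Qed.

Lemma ideal_gen_mulr a u : u \in ideal_gen gs -> u * a \in ideal_gen gs.
Proof.
by move=> Ju; have [_ _ JM] := ideal_gen_ideal; rewrite -[u]mul1r JM.
Qed.

End IdealGen.

(* [ring_quotient] only provides ring structures on quotients of nonzero       *)
(* commutative rings by proper ideals.                                         *)
Definition quot_ring (R : pzRingType) (gs : seq R) : Type :=
  Quotient.quot (ideal_gen gs).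

Section QuotRing.
Variables (R : pzRingType) (gs : seq R).
Local Notation Q := (quot_ring gs).

HB.instance Definition _ := GRing.Zmodule.copy Q (Quotient.quot (ideal_gen gs)).

Definition quot_pi (r : R) : Q := \pi_(Quotient.quot (ideal_gen gs)) r.
Definition quot_repr (q : Q) : R :=
  repr (q : Quotient.quot (ideal_gen gs)).

Lemma quot_reprK : cancel quot_repr quot_pi.
Proof. exact: reprK. Qed.

Lemma quot_piE r1 r2 :
  (quot_pi r1 == quot_pi r2) = (r1 - r2 \in ideal_gen gs).
Proof. by rewrite Quotient.idealrBE. Qed.

Lemma quot_pi_is_zmod_morphism : zmod_morphism quot_pi.
Proof.
by move=> r1 r2; exact: (raddfB \pi_(Quotient.quot (ideal_gen gs))).
Qed.

HB.instance Definition _ := GRing.isZmodMorphism.Build R Q quot_pi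
  quot_pi_is_zmod_morphism.

Definition quot_one : Q := quot_pi 1.
Definition quot_mul (q1 q2 : Q) : Q := quot_pi (quot_repr q1 * quot_repr q2).

Lemma quot_mul_pi r1 r2 :
  quot_mul (quot_pi r1) (quot_pi r2) = quot_pi (r1 * r2).
Proof.
have reprE r : quot_repr (quot_pi r) - r \in ideal_gen gs.
  by rewrite -quot_piE quot_reprK.
apply/eqP; rewrite quot_piE.
set s1 := quot_repr _; set s2 := quot_repr _.
have -> : s1 * s2 - r1 * r2 = (s1 - r1) * s2 + r1 * (s2 - r2).
  by rewrite mulrBl mulrBr addrA subrK.
by apply: rpredD; [apply: ideal_gen_mulr | apply: ideal_gen_mull]; exact: reprE.
Qed.

Lemma quot_mulA : associative quot_mul.
Proof.
move=> q1 q2 q3; rewrite -[q1]quot_reprK -[q2]quot_reprK -[q3]quot_reprK.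
by rewrite !quot_mul_pi mulrA.
Qed.

Lemma quot_mul1l : left_id quot_one quot_mul.
Proof. by move=> q; rewrite -[q]quot_reprK quot_mul_pi mul1r. Qed.

Lemma quot_mul1r : right_id quot_one quot_mul.
Proof. by move=> q; rewrite -[q]quot_reprK quot_mul_pi mulr1. Qed.

Lemma quot_mulDl : left_distributive quot_mul +%R.
Proof.
move=> q1 q2 q3; rewrite -[q1]quot_reprK -[q2]quot_reprK -[q3]quot_reprK.
by rewrite -raddfD !quot_mul_pi mulrDl raddfD.
Qed.

Lemma quot_mulDr : right_distributive quot_mul +%R.
Proof.
move=> q1 q2 q3; rewrite -[q1]quot_reprK -[q2]quot_reprK -[q3]quot_reprK.
by rewrite -raddfD !quot_mul_pi mulrDr raddfD.
Qed.

HB.instance Definition _ := GRing.Zmodule_isPzRing.Build Q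
  quot_mulA quot_mul1l quot_mul1r quot_mulDl quot_mulDr.

Lemma quot_pi_is_monoid_morphism : monoid_morphism quot_pi.
Proof. by split=> // r1 r2; exact/esym/quot_mul_pi. Qed.

HB.instance Definition _ := GRing.isMonoidMorphism.Build R Q quot_pi
  quot_pi_is_monoid_morphism.

End QuotRing.

Section QuotComRing.
Variables (R : comPzRingType) (gs : seq R).

Lemma quot_mulC : commutative (@GRing.mul (quot_ring gs)).
Proof.
move=> q1 q2; rewrite -[q1]quot_reprK -[q2]quot_reprK.
by rewrite -!(rmorphM (@quot_pi R gs)) mulrC.
Qed.

HB.instance Definition _ := GRing.PzRing_hasCommutativeMul.Build (quot_ring gs)
  quot_mulC.

End QuotComRing.

Definition quotC (A : pzRingType) (M : monomType) (gs : seq (monalg A M))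
  (a : A) : quot_ring gs := quot_pi gs (monalgC M a).

HB.instance Definition _ (A : pzRingType) (M : monomType)
  (gs : seq (monalg A M)) :=
  GRing.RMorphism.copy (@quotC A M gs) (@quot_pi _ gs \o @monalgC A M).

(* A<x,y>: the algebra of the free monoid on two letters *)
Definition free2 (A : pzRingType) := monalg A {fmonom 'I_2}.
(* A[s,t]: the algebra of the free commutative monoid on two letters *)
Definition poly2 (A : pzRingType) := monalg A 'X_{1..2}.

Definition R_rels (A : pzRingType) (i j : nat) : seq (free2 A) :=
  let x : free2 A := monalgX A (fmu ord0) in
  let y : free2 A := monalgX A (fmu ord_max) in
  [:: x ^+ i * y + y * x ^+ j - 1; y ^+ 2].

Definition Rij11 (A : pzRingType) (i j : nat) := quot_ring (R_rels A i j).

Fixpoint lucas (R : pzRingType) (s t : R) (n : nat) : R :=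
  match n with
  | 0 => 0
  | n'.+1 => match n' with
             | 0 => 1
             | n''.+1 => t * lucas s t n' + s * lucas s t n''
             end
  end.

(* In all uses j >= 1 and i >= j, so the truncated subtractions are exact. *)
Definition I_gens (A : pzRingType) (i j : nat) : seq (poly2 A) :=
  let s : poly2 A := monalgX A (ucm ord0) in
  let t : poly2 A := monalgX A (ucm ord_max) in
  [:: lucas s t (i + j);
      lucas s t (i + j - 1) - s ^+ (j - 1);
      s ^+ (i - j) - (-1) ^+ (i - j)].

Definition poly2_mod_I (A : pzRingType) (i j : nat) :=
  quot_ring (I_gens A i j).

(* Main.v *)
From HB Require Import structures.
Require Import Defs.
From mathcomp Require Import all_boot all_order all_algebra.
From mathcomp Require Import finmap boolp ring.
From mathcomp.multinomials Require Import monalg.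

Set Implicit Arguments.
Unset Strict Implicit.
Unset Printing Implicit Defensive.

Import GRing.Theory.

Local Open Scope ring_scope.

(** Write R for the ring generated by x and y.  The equations
    x^i y + y x^j = 1 and y^2 = 0 make y behave like the elementary matrix E01:
    they give y x^i y = y = y x^j y, so that y x^j, y, x^i y x^j and x^i y form
    a complete system of two by two matrix units ([split_unitM],
    [split_unit1]).  Hence R is a ring of two by two matrices with y = E01, and
    the first relation says which entries of x^i and x^j vanish or equal 1.

    Comparing the products x^i x^j and x^j x^i gives more, namely the mirror
    relation x^j y + y x^i = 1 ([split_sym]).  It follows that p = x^(i+j) and
    u = x^j - x^i are central, and in terms of the matrix units
    x^i = (0, p; 1, -u) and x^j = (u, p; 1, 0) are matrices over the center.
    When i > j the element p is invertible ([prod_unit]): the ideal (u, p) is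
    the unit ideal, as x^j lies in it, while u is nilpotent modulo p.  From
    gcd(i, i+j) = 1, some power of x^i is x times a power of p; dividing by the
    latter, x itself is a matrix X over the center ([center_splitting]), so
    everything is now commutative.

    Over a commutative ring, put t = tr X and s = -det X, and let f be the Lucas
    sequence of s and t, so that X^n = f(n) X + s f(n-1).  The shape of X^i and
    X^j says exactly that f(i) = f(j) is inverse to the entry X10, and that
    X is a certain explicit matrix in s, t and X10.  It forces f(i+j) = 0,
    f(i+j-1) = (-s)^(j-1) and (-s)^(i-j) = 1 ([powers_lucas_mx]).  Conversely
    these three equations imply that f(i) = f(j) is invertible
    ([lucas_rel_unit], where gcd(i, j) = 1 enters through the divisibility
    properties of f), and then the explicit matrix is a solution
    ([lucas_mx_powers]).  Replacing t by (-1)^(j-1) t turns the three equations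
    into the generators of the ideal I ([lucas_rel_sign]).

    So sending x to the explicit matrix and y to E01 maps R to the matrices over
    Q = A[s,t]/I, while s and t determine a map from Q to the center of R, and
    hence from the matrices over Q to R.  The two maps are inverse to each
    other. *)

(** * Universal properties *)

Section MonalgEval.
Variables (A S : pzRingType) (M : monomType).
Variables (f : {rmorphism A -> S}) (h : M -> S).
Hypothesis h1 : h (@one M) = 1.
Hypothesis hM : forall k l, h (mmul k l) = h k * h l.
Hypothesis comm_fh : forall a k, f a * h k = h k * f a.

Definition monalg_eval (g : monalg A M) : S :=
  \sum_(k <- msupp (g : {malg A[M]})) f (mcoeff k g) * h k.

Lemma monalg_evalw (d : {fset M}) (g : monalg A M) :
  fsubset (msupp (g : {malg A[M]})) d ->
  monalg_eval g = \sum_(k <- d) f (mcoeff k g) * h k.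
Proof.
move=> le; rewrite /monalg_eval (big_fset_incl _ le) //= => k _.
by move=> /mcoeff_outdom ->; rewrite raddf0 mul0r.
Qed.

Lemma monalg_evalU c k : monalg_eval << c *g k >> = f c * h k.
Proof. by rewrite (monalg_evalw msuppU_le) big_seq_fset1 mcoeffUU. Qed.

Lemma monalg_eval_is_zmod_morphism : zmod_morphism monalg_eval.
Proof.
move=> g1 g2.
have supp1 := fsubsetUl (msupp (g1 : {malg A[M]})) (msupp (g2 : {malg A[M]})).
have supp2 := fsubsetUr (msupp (g1 : {malg A[M]})) (msupp (g2 : {malg A[M]})).
rewrite (monalg_evalw supp1) (monalg_evalw supp2).
rewrite (@monalg_evalw _ (g1 - g2) (msuppB_le (g1 : {malg A[M]}) g2)).
rewrite -sumrB; apply: eq_bigr => k _.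
by rewrite (@mcoeffB M A k) raddfB mulrBl.
Qed.

HB.instance Definition _ := GRing.isZmodMorphism.Build (monalg A M) S
  monalg_eval monalg_eval_is_zmod_morphism.

Lemma monalg_eval_is_monoid_morphism : monoid_morphism monalg_eval.
Proof.
split=> [|g1 g2].
  by apply: (etrans (monalg_evalU 1 (@one M))); rewrite h1 rmorph1 mulr1.
have -> : g1 * g2 = monalg_mul (g1 : {malg A[M]}) g2 :> monalg A M by [].
rewrite /monalg_mul (raddf_sum monalg_eval) /= /monalg_eval mulr_suml.
apply: eq_bigr => k _.
rewrite -/(monalg_eval _) (raddf_sum monalg_eval) /= mulr_sumr.
apply: eq_bigr => l _.
by rewrite monalg_evalU rmorphM hM -!mulrA (mulrA (h k)) -comm_fh !mulrA.
Qed.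

HB.instance Definition _ := GRing.isMonoidMorphism.Build (monalg A M) S
  monalg_eval monalg_eval_is_monoid_morphism.

Lemma monalg_lift : exists F : {rmorphism monalg A M -> S},
  (forall a, F (monalgC M a) = f a) /\ (forall k, F (monalgX A k) = h k).
Proof.
exists (monalg_eval : {rmorphism monalg A M -> S}); split=> [a|k].
  by apply: (etrans (monalg_evalU a (@one M))); rewrite h1 mulr1.
by apply: (etrans (monalg_evalU 1 k)); rewrite rmorph1 mul1r.
Qed.

End MonalgEval.

Section MonalgGenerators.
Variables (A S : pzRingType).

Lemma monalgX1 (M : monomType) : monalgX A (@one M) = 1.
Proof. by []. Qed.

Lemma monalgXM (M : monomType) (k l : M) :
  monalgX A (mmul k l) = monalgX A k * monalgX A l.
Proof. by rewrite /GRing.mul /= monalg_mulUU mulr1. Qed.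

Lemma monalg_sum (M : monomType) (g : monalg A M) :
  g = \sum_(k <- msupp (g : {malg A[M]})) monalgC M (mcoeff k g) * monalgX A k.
Proof.
rewrite [LHS](@monalgE M A g); apply: eq_bigr => k _.
by rewrite /GRing.mul /= monalg_mulUU mulr1 mul1m.
Qed.

Lemma monalg_ext (M : monomType) (F G : {rmorphism monalg A M -> S}) :
    (forall a, F (monalgC M a) = G (monalgC M a)) ->
    (forall k, F (monalgX A k) = G (monalgX A k)) ->
  F =1 G.
Proof.
move=> eqC eqX g; rewrite (monalg_sum g) !raddf_sum; apply: eq_bigr => k _ /=.
by rewrite !rmorphM /= eqC eqX.
Qed.

Lemma fmonom_ind (I : choiceType) (P : {fmonom I} -> Prop) :
    P (@one {fmonom I}) -> (forall i m, P m -> P (mmul (fmu i) m)) ->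
  forall m, P m.
Proof.
move=> P1 PM [s]; elim: s => [|i s IHs].
  by have -> : FMonom [::] = @one {fmonom I} by apply/val_inj; rewrite /= fm1.
suff -> : FMonom (i :: s) = mmul (fmu i) (FMonom s) by exact: PM.
by apply/val_inj; rewrite /= fmM fmU.
Qed.

(** Induction on the total degree: a monomial of positive degree is divisible by
    some indeterminate. *)
Lemma cmonom_ind (I : choiceType) (P : {cmonom I} -> Prop) :
    P (@one {cmonom I}) -> (forall i m, P m -> P (mmul (ucm i) m)) ->
  forall m, P m.
Proof.
move=> P1 PM m; move: {2}(mdeg m) (erefl (mdeg m)) => n.
elim: n m => [|n IHn] m deg_m.
  by have /eqP : mdeg m == 0%N; [rewrite deg_m | move/mdeg_eq0I ->].
have [i mi_gt0] : exists i, m i != 0%N.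
  have [m0|[i]] := fset_0Vmem (finsupp m); last by rewrite -cmE_neq0; exists i.
  by move: deg_m; rewrite mdegE m0 big_seq_fset0.
have def_m : m = mmul (ucm i) (divcm m (ucm i)).
  apply/eqP/cmP=> l; rewrite cmM divcmE subnKC // cmU.
  by case: eqVneq => // <-; rewrite lt0n.
rewrite def_m; apply/PM/IHn; move: deg_m.
by rewrite {1}def_m mdegM mdegU => -[].
Qed.

(** Values of the indeterminates may fail to commute with each other, but a
    scalar has to commute with all of them, as it does in the source. *)
Lemma free_lift (I : choiceType) (f : {rmorphism A -> S}) (v : I -> S) :
    (forall a i, f a * v i = v i * f a) ->
  exists F : {rmorphism monalg A {fmonom I} -> S},
    (forall a, F (monalgC _ a) = f a) /\
    (forall i, F (monalgX A (fmu i)) = v i).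
Proof.
move=> comm_fv; pose h (m : {fmonom I}) := \prod_(i <- m : seq I) v i.
have [] := @monalg_lift A S _ f h.
- by rewrite /h fm1 big_nil.
- by move=> k l; rewrite /h fmM big_cat.
- move=> a k; rewrite /h; elim/big_rec: _ => [|i y _ IH].
    by rewrite mulr1 mul1r.
  by rewrite mulrA comm_fv -mulrA IH mulrA.
move=> F [FC FX]; exists F; split=> // i.
by rewrite FX /h fmU big_seq1.
Qed.

Lemma free_ext (I : choiceType) (F G : {rmorphism monalg A {fmonom I} -> S}) :
    (forall a, F (monalgC _ a) = G (monalgC _ a)) ->
    (forall i, F (monalgX A (fmu i)) = G (monalgX A (fmu i))) ->
  F =1 G.
Proof.
move=> eqC eqX; apply: monalg_ext => //; apply: fmonom_ind.
  by rewrite monalgX1 !rmorph1.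
by move=> i m IHm; rewrite monalgXM !rmorphM /= eqX IHm.
Qed.

Lemma poly_ext (I : choiceType) (F G : {rmorphism monalg A {cmonom I} -> S}) :
    (forall a, F (monalgC _ a) = G (monalgC _ a)) ->
    (forall i, F (monalgX A (ucm i)) = G (monalgX A (ucm i))) ->
  F =1 G.
Proof.
move=> eqC eqX; apply: monalg_ext => //; apply: cmonom_ind.
  by rewrite monalgX1 !rmorph1.
move=> i m IHm; rewrite (monalgXM (ucm i) m).
rewrite (rmorphM F).
rewrite (rmorphM G).
exact: (congr2 *%R (eqX i) IHm).
Qed.

End MonalgGenerators.

Lemma poly_lift (A : pzRingType) (S : comPzRingType) (I : finType)
    (f : {rmorphism A -> S}) (v : I -> S) :
  exists F : {rmorphism monalg A {cmonom I} -> S},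
    (forall a, F (monalgC _ a) = f a) /\
    (forall i, F (monalgX A (ucm i)) = v i).
Proof.
pose h (m : {cmonom I}) := \prod_i v i ^+ m i.
have [] := @monalg_lift A S _ f h.
- by rewrite /h big1 // => i _; rewrite cm1.
- move=> k l; rewrite /h -big_split; apply: eq_bigr => i _.
  by rewrite cmM exprD.
- by move=> a k; rewrite mulrC.
move=> F [FC FX]; exists F; split=> // i.
rewrite FX /h (bigD1 i) //= cmUU big1 ?mulr1 // => l.
by rewrite cmU eq_sym => /negPf ->.
Qed.

Section QuotLift.
Variables (P S : pzRingType) (gs : seq P) (F : {rmorphism P -> S}).
Hypothesis F_gs : {in gs, forall g, F g = 0}.

Lemma ker_ideal_gen r : r \in ideal_gen gs -> F r = 0.
Proof.
move=> /ideal_genP /(_ (fun r => F r == 0)) F0; apply/eqP/F0.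
  split=> [|u v /eqP Fu /eqP Fv|a b u /eqP Fu]; apply/eqP.
  - exact: rmorph0.
  - by rewrite rmorphD Fu Fv addr0.
  - by rewrite !rmorphM Fu mulr0 mul0r.
by move=> g /F_gs /eqP.
Qed.

Definition quot_eval (q : quot_ring gs) : S := F (quot_repr q).

Lemma quot_eval_pi r : quot_eval (quot_pi gs r) = F r.
Proof.
apply/eqP; rewrite -subr_eq0 -rmorphB; apply/eqP/ker_ideal_gen.
by rewrite -quot_piE quot_reprK.
Qed.

Lemma quot_eval_is_zmod_morphism : zmod_morphism quot_eval.
Proof.
move=> q1 q2; rewrite -[q1]quot_reprK -[q2]quot_reprK -raddfB.
by rewrite !quot_eval_pi rmorphB.
Qed.

Lemma quot_eval_is_monoid_morphism : monoid_morphism quot_eval.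
Proof.
split=> [|q1 q2]; first by rewrite quot_eval_pi rmorph1.
by rewrite -[q1]quot_reprK -[q2]quot_reprK -rmorphM !quot_eval_pi rmorphM.
Qed.

HB.instance Definition _ := GRing.isZmodMorphism.Build _ _ quot_eval
  quot_eval_is_zmod_morphism.
HB.instance Definition _ := GRing.isMonoidMorphism.Build _ _ quot_eval
  quot_eval_is_monoid_morphism.

Lemma quot_lift :
  exists G : {rmorphism quot_ring gs -> S}, forall r, G (quot_pi gs r) = F r.
Proof.
by exists (quot_eval : {rmorphism _ -> _}) => r; exact: quot_eval_pi.
Qed.

End QuotLift.

(** * The center as a commutative ring *)

(** Classical truth makes the center a boolean predicate, which is what the
    subtype below needs. *)
Definition central (R : pzRingType) : {pred R} :=
  fun r => `[< forall z, r * z = z * r >].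

Section Center.
Variable R : pzRingType.

Lemma centralP (r : R) : reflect (forall z, r * z = z * r) (r \in @central R).
Proof. exact: asboolP. Qed.

Lemma central_subring_closed : subring_closed (@central R).
Proof.
split=> [|a b /centralP ca /centralP cb|a b /centralP ca /centralP cb];
  apply/centralP => z.
- by rewrite mul1r mulr1.
- by rewrite mulrBl mulrBr ca cb.
- by rewrite -mulrA cb mulrA ca mulrA.
Qed.

Record center := Center { center_val : R; _ : center_val \in @central R }.

HB.instance Definition _ := [isSub for center_val].
HB.instance Definition _ := [Choice of center by <:].
HB.instance Definition _ := 
  GRing.SubChoice_isSubPzRing.Build R (@central R) center
    central_subring_closed.

Lemma center_mulC : commutative (@GRing.mul center).
Proof.
by move=> a b; apply: val_inj; rewrite !rmorphM /=; case: a => a /= /centralP.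
Qed.

HB.instance Definition _ := GRing.PzRing_hasCommutativeMul.Build center
  center_mulC.

Lemma center_comm (a : center) (z : R) : val a * z = z * val a.
Proof. by case: a => a /= /centralP. Qed.

End Center.

(** * Matrix units *)

Section MatrixUnits.
Variables (K R : pzRingType) (n : nat) (h : {rmorphism K -> R}).
Variable (e : 'I_n -> 'I_n -> R).
Hypothesis h_central : forall a r, h a * r = r * h a.
Hypothesis eM : forall i j k l, e i j * e k l = e i l *+ (j == k).
Hypothesis e1 : \sum_i e i i = 1.

Definition mx_eval (X : 'M[K]_n) : R := \sum_i \sum_j h (X i j) * e i j.

Lemma mx_eval_is_zmod_morphism : zmod_morphism mx_eval.
Proof.
move=> X Y; rewrite /mx_eval -sumrB; apply: eq_bigr => i _.
by rewrite -sumrB; apply: eq_bigr => j _; rewrite !mxE rmorphB mulrBl.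
Qed.

Lemma mx_eval_scalar a : mx_eval a%:M = h a.
Proof.
rewrite -[RHS]mulr1 -e1 mulr_sumr; apply: eq_bigr => i _.
rewrite (bigD1 i) //= big1 => [|j /negPf]; first by rewrite mxE eqxx addr0.
by rewrite mxE eq_sym => ->; rewrite rmorph0 mul0r.
Qed.

Lemma mx_eval_is_monoid_morphism : monoid_morphism mx_eval.
Proof.
split=> [|X Y]; first by rewrite [LHS]mx_eval_scalar rmorph1.
rewrite /mx_eval mulr_suml; apply: eq_bigr => i _.
rewrite mulr_suml.
under eq_bigr do rewrite mxE rmorph_sum mulr_suml.
rewrite exchange_big; apply: eq_bigr => j _ /=.
rewrite mulr_sumr [RHS](bigD1 j) //= [X in _ = _ + X]big1 ?addr0 => [|k /negPf].
  rewrite mulr_sumr; apply: eq_bigr => l _.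
  by rewrite rmorphM -!mulrA [e i j * _]mulrA -h_central -mulrA eM eqxx.
rewrite eq_sym => jk; rewrite mulr_sumr big1 // => l _.
by rewrite -mulrA [e i j * _]mulrA -h_central -mulrA eM jk !mulr0.
Qed.

HB.instance Definition _ := GRing.isZmodMorphism.Build _ _ mx_eval
  mx_eval_is_zmod_morphism.
HB.instance Definition _ := GRing.isMonoidMorphism.Build _ _ mx_eval
  mx_eval_is_monoid_morphism.

(** The sandwich [e k i * _ * e j k] moves the coefficient of [e i j] to the
    diagonal position [k], so summing over [k] isolates that coefficient. *)
Lemma mx_eval_coef X i j : \sum_k e k i * mx_eval X * e j k = h (X i j).
Proof.
rewrite -[RHS]mulr1 -e1 mulr_sumr; apply: eq_bigr => k _.
rewrite /mx_eval mulr_sumr mulr_suml (bigD1 i) //=.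
rewrite [X in _ + X]big1 ?addr0 => [|l /negPf].
  rewrite mulr_sumr mulr_suml (bigD1 j) //=.
  rewrite [X in _ + X]big1 ?addr0 => [|l /negPf lj].
    rewrite [e k i * _]mulrA -h_central -!mulrA !eM eqxx mulrA -mulrA.
    by rewrite eM eqxx.
  by rewrite -!mulrA eM lj !mulr0.
rewrite eq_sym => il; rewrite mulr_sumr mulr_suml big1 // => m _.
rewrite [e k i * _]mulrA -h_central -!mulrA [e k i * _]mulrA eM il.
by rewrite mul0r mulr0.
Qed.

Lemma mx_lift : exists F : {rmorphism 'M[K]_n -> R},
    [/\ forall X, F X = \sum_i \sum_j h (X i j) * e i j,
        forall a, F a%:M = h a
      & injective h -> injective F].
Proof.
exists (mx_eval : {rmorphism 'M[K]_n -> R}).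
split=> // [a|h_inj X Y eXY]; first exact: mx_eval_scalar.
apply/matrixP => i j; apply: h_inj; rewrite -!mx_eval_coef.
by apply: eq_bigr => k _; congr (_ * _ * _).
Qed.

End MatrixUnits.

(** * Lucas sequences *)

Section Lucas.
Variables (K : comPzRingType).
Implicit Types (s t : K) (m n k : nat).

Lemma lucasSS s t n : lucas s t n.+2 = t * lucas s t n.+1 + s * lucas s t n.
Proof. by []. Qed.

Lemma rmorph_lucas (L : comPzRingType) (f : {rmorphism K -> L}) s t n :
  f (lucas s t n) = lucas (f s) (f t) n.
Proof.
elim/ltn_ind: n => -[|[|n]] IHn; rewrite ?rmorph0 ?rmorph1 //.
by rewrite !lucasSS rmorphD !rmorphM !IHn.
Qed.

Lemma lucas_add s t m n :
  lucas s t (m + n).+1 =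
    lucas s t m.+1 * lucas s t n.+1 + s * lucas s t m * lucas s t n.
Proof.
elim: n m => [|n IHn] m; first by rewrite addn0 /=; ring.
by rewrite addnS -addSn IHn !lucasSS; ring.
Qed.

(** d'Ocagne's identity.  For [n = 1] it becomes Cassini's identity, and it
    shows that [f (n + k) = 0] ties [f n] to [f k] up to powers of [- s]. *)
Lemma lucas_docagne s t n k :
  lucas s t n * (- s) ^+ k =
    lucas s t (n + k) * lucas s t k.+1 - lucas s t (n + k).+1 * lucas s t k.
Proof.
elim: k => [|k IHk]; first by rewrite addn0 /=; ring.
by rewrite exprSr mulrA IHk addnS !lucasSS; ring.
Qed.

Lemma lucas_dvd s t n k : exists h, lucas s t (k * n) = lucas s t n * h.
Proof.
case: n => [|n]; first by exists 0; rewrite muln0 mul0r.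
elim: k => [|k [h IHk]]; first by exists 0; rewrite mulr0.
exists (lucas s t (k * n.+1).+1 + s * h * lucas s t n).
by rewrite mulSnr addnS lucas_add IHk; ring.
Qed.

(** With [t] of weight 1 and [s] of weight 2, f(n+1) is homogeneous of weight n,
    and the square of the scaling factor is 1. *)
Lemma lucas_scale e s t n : e ^+ 2 = 1 ->
  lucas s (e * t) n.+1 = e ^+ n * lucas s t n.+1.
Proof.
move=> e2; elim/ltn_ind: n => -[|[|n]] IHn.
- by rewrite expr0 mul1r.
- by rewrite /= expr1; ring.
have en2 : e ^+ n.+2 = e ^+ n by rewrite -addn2 exprD e2 mulr1.
rewrite (lucasSS s (e * t)) (lucasSS s t) !IHn // [RHS]mulrDr.
by congr (_ + _); [rewrite [e ^+ n.+2]exprS | rewrite en2]; ring.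
Qed.

End Lucas.

(** * Two by two matrices *)

Section Matrices2.
Variable K : comPzRingType.
Implicit Types (X Y : 'M[K]_2) (s t : K).

Definition mx2 (a b c d : K) : 'M[K]_2 :=
  \matrix_(i, j) if i == 0 then if j == 0 then a else b
                 else if j == 0 then c else d.

Lemma mx2E a b c d :
  (mx2 a b c d 0 0 = a) * (mx2 a b c d 0 1 = b) *
  (mx2 a b c d 1 0 = c) * (mx2 a b c d 1 1 = d).
Proof. by rewrite !mxE. Qed.

Lemma ord2P (P : 'I_2 -> Prop) : P 0 -> P 1 -> forall i, P i.
Proof.
move=> P0 P1 [[|[|i]] lti] //; [move: P0 | move: P1].
  by congr P; apply: val_inj.
by congr P; apply: val_inj.
Qed.

Lemma matrix2P X Y : X 0 0 = Y 0 0 -> X 0 1 = Y 0 1 -> X 1 0 = Y 1 0 ->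
  X 1 1 = Y 1 1 -> X = Y.
Proof. by move=> ? ? ? ?; apply/matrixP; do 2!apply: ord2P. Qed.

Lemma sum2 (V : nmodType) (F : 'I_2 -> V) : \sum_i F i = F 0 + F 1.
Proof.
by rewrite !big_ord_recl big_ord0 addr0; congr (_ + F _); apply: val_inj.
Qed.

Lemma mul2E X Y i j : (X * Y) i j = X i 0 * Y 0 j + X i 1 * Y 1 j.
Proof. by rewrite mxE sum2. Qed.

Definition trace2 X := X 0 0 + X 1 1.

(** The characteristic polynomial of [X] is T^2 - trace2 X * T - normN2 X, so
    that trace2 and normN2 are the parameters [t] and [s] of its Lucas
    sequence. *)
Definition normN2 X := X 0 1 * X 1 0 - X 0 0 * X 1 1.

(** By Cayley and Hamilton the powers of [X] are combinations of [X] and 1, and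
    the coefficients obey the Lucas recurrence. *)
Lemma exp2_lucas X n : let f := lucas (normN2 X) (trace2 X) in
  X ^+ n.+1 = f n.+1 *: X + (normN2 X * f n)%:M.
Proof.
move=> f; elim: n => [|n IHn].
  by apply: matrix2P; rewrite expr1 !mxE ?(mulr0n, mulr1n) /f /=; ring.
rewrite exprSr IHn.
apply: matrix2P; rewrite mul2E !mxE ?(mulr0n, mulr1n) /f lucasSS.
all: by rewrite /trace2 /normN2; ring.
Qed.

End Matrices2.

(** * Matrices with prescribed powers *)

#[local] Arguments lucas : simpl never.

Section LucasMatrices.
Variable K : comPzRingType.
Implicit Types (s t c p u q : K) (i j : nat).

(** The equations that s = - det X and t = tr X satisfy; they carry the signs of
    [- s], and [lucas_rel_sign] trades them for the generators of I. *)
Definition lucas_rel s t i j : Prop :=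
  [/\ lucas s t (i + j) = 0,
      lucas s t (i + j).-1 = (- s) ^+ j.-1
    & (- s) ^+ (i - j) = 1].

(** The values of x^i and x^j in the matrix units where y is E01: they satisfy
    power_i * E01 + E01 * power_j = 1, their product is the scalar [p], and
    their difference is the scalar [u]. *)
Definition power_i p u := mx2 0 p 1 (- u).
Definition power_j p u := mx2 u p 1 0.

(** The values that [p] and [u] must take in terms of [s] and [t], read off from
    X^(i+j) = f(i+j) X + s f(i+j-1) and X^j - X^i, when f(i+j) = 0 and
    f(i) = f(j). *)
Definition lucas_p s t i j := s * lucas s t (i + j).-1.
Definition lucas_u s t i j := s * (lucas s t j.-1 - lucas s t i.-1).

(** The only candidate for the matrix X: [c] stands for the inverse of f(i), and
    X is solved from f(i) X + s f(i-1) = X^i, with its last entry taken from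
    the analogous equation for X^j. *)
Definition lucas_mx s t c i j := mx2
  (- (c * s * lucas s t i.-1)) (c * lucas_p s t i j)
  c                            (- (c * s * lucas s t j.-1)).

Lemma unit_cancel (a b x y : K) : a * b = 1 -> x * a = y * a -> x = y.
Proof. by move=> ab e; rewrite -[x]mulr1 -[y]mulr1 -ab !mulrA e. Qed.

(** d'Ocagne's identity at (i, j-1) compares f(i) with f(j) after cancelling
    (-s)^(j-1).  For invertibility, choose k and n with k i = n j + 1: the
    identity at (1, n j) writes a power of -s as a combination of f(k i) and
    f(n j), which are multiples of f(i) and f(j).  If i = j then i = j = 1,
    where f(1) = 1 and s need not be invertible. *)
Lemma lucas_rel_unit s t i j : (1 <= j)%N -> (j <= i)%N -> gcdn i j = 1%N ->
    lucas_rel s t i j ->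
  lucas s t i = lucas s t j /\ exists c, lucas s t i * c = 1.
Proof.
case: j => // j _; rewrite leq_eqVlt => /orP[/eqP <-|ltji].
  by rewrite gcdnn => -[->] _; split=> //; exists 1; rewrite mulr1.
move=> co_ij [f_ij f_ij1 s_ij].
(* As (-s)^(i-j) = 1 and i - j > 0, every power of -s is invertible. *)
have s_unit k : (- s) ^+ k * (- s) ^+ ((i - j.+1).-1 * k) = 1.
  rewrite -exprD -{1}[k]mul1n -mulnDl add1n prednK ?subn_gt0 //.
  by rewrite exprM s_ij expr1n.
have eq_f : lucas s t i = lucas s t j.+1.
  apply: (unit_cancel (s_unit j)); move: (lucas_docagne s t i j).
  rewrite -addnS f_ij mul0r subr0 => ->.
  by rewrite addnS in f_ij1; rewrite f_ij1 mulrC.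
split=> //.
have i_gt0 : (0 < i)%N by exact: leq_trans ltji.
have [k n def_k _] := egcdnP j.+1 i_gt0; rewrite co_ij in def_k.
have [h1 H1] := lucas_dvd s t i k.
have [h2 H2] := lucas_dvd s t j.+1 n.
have := lucas_docagne s t 1 (n * j.+1).
rewrite add1n -[X in lucas s t X * _ - _]addn1 -def_k H1 H2 -eq_f => E.
exists ((h1 * lucas s t (n * j.+1).+1 - lucas s t (n * j.+1).+2 * h2)
        * (- s) ^+ ((i - j.+1).-1 * (n * j.+1))).
rewrite mulrA -(s_unit (n * j.+1)%N); congr (_ * _).
by move: E; rewrite [lucas s t 1]/= mul1r => ->; ring.
Qed.

(** Once trace and determinant are known to be the expected ones, powers are
    computed by the Lucas sequence.  The trace is right because
    0 = f(i+j) = f(i) (f(i+1) + s f(j-1)), and the determinant because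
    f(i+j-1) = f(i)^2 + s f(i-1) f(j-1). *)
Lemma lucas_mx_powers s t c i j : (1 <= j)%N -> (1 <= i)%N ->
    lucas s t i = lucas s t j -> lucas s t i * c = 1 ->
    lucas s t (i + j) = 0 ->
  let X := lucas_mx s t c i j in
  [/\ trace2 X = t, normN2 X = s,
      X ^+ i = power_i (lucas_p s t i j) (lucas_u s t i j)
    & X ^+ j = power_j (lucas_p s t i j) (lucas_u s t i j)].
Proof.
case: i j => // i [] // j _ _ eq_f unit_f f_ij X.
have c_unit : c * lucas s t i.+1 = 1 by rewrite mulrC.
have f_i2 : lucas s t i.+2 = - (s * lucas s t j).
  apply: (unit_cancel unit_f); apply/eqP; rewrite -subr_eq0 -f_ij.
  by rewrite addnS lucas_add -eq_f; apply/eqP; ring.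
have f_ij1 : lucas s t (i.+1 + j)
    = lucas s t i.+1 ^+ 2 + s * lucas s t i * lucas s t j.
  by rewrite addSn lucas_add -eq_f expr2.
have trX : trace2 X = t.
  rewrite /trace2 !mx2E /=; apply: (unit_cancel unit_f).
  move: f_i2; rewrite lucasSS => /(canRL (addrK _)) ->.
  have -> : (- (c * s * lucas s t i) - c * s * lucas s t j) * lucas s t i.+1
     = - (c * lucas s t i.+1) * (s * lucas s t i + s * lucas s t j) by ring.
  by rewrite c_unit; ring.
have nX : normN2 X = s.
  rewrite /normN2 !mx2E /lucas_p addnS !succnK f_ij1.
  transitivity (s * (c * lucas s t i.+1) ^+ 2); first by ring.
  by rewrite c_unit; ring.
have E z : lucas s t i.+1 * - (c * s * z) = - (s * z).
  by rewrite -(mul1r (s * z)) -unit_f; ring.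
split=> //; rewrite exp2_lucas trX nX -?eq_f; apply: matrix2P.
all: rewrite !mxE ?(mulr0n, mulr1n) /= /lucas_u /=.
all: rewrite ?E ?[_ * (c * _)]mulrA ?unit_f; ring.
Qed.

(** Here f(i) and f(j) are both inverse to X10, hence equal.  The zero entries
    of X^i and X^j give the diagonal of X, and f(i+j) = 0 since X^(i+j) is
    scalar.  Both (-s)^(i-1) and (-s)^(j-1) equal f(i+j-1), by Cassini's
    identity, which gives the last equation when i > j because s divides the
    unit p. *)
Lemma powers_lucas_mx (X : 'M[K]_2) p u i j : (1 <= j)%N -> (j <= i)%N ->
    ((j < i)%N -> exists q, p * q = 1) ->
    X ^+ i = power_i p u -> X ^+ j = power_j p u ->
  let s := normN2 X in let t := trace2 X in
  [/\ lucas_rel s t i j, lucas s t i * X 1 0 = 1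
    & X = lucas_mx s t (X 1 0) i j].
Proof.
move=> j_gt0 le_ji p_unit Xi Xj s t.
have i_gt0 := leq_trans j_gt0 le_ji.
case: i i_gt0 le_ji p_unit Xi => // i _ le_ji p_unit Xi.
case: j j_gt0 le_ji p_unit Xj => // j _ le_ji p_unit Xj.
have Xp : X ^+ (i.+1 + j.+1) = p%:M.
  rewrite exprD Xi Xj.
  by apply: matrix2P; rewrite mul2E !mxE ?(mulr0n, mulr1n) /=; ring.
have := Xi; rewrite exp2_lucas -/s -/t => /matrixP ei.
have := Xj; rewrite exp2_lucas -/s -/t => /matrixP ej.
have := Xp; rewrite addSn exp2_lucas -/s -/t => /matrixP ep.
have := ei 1 0; rewrite !mxE mulr0n addr0 /= => ei10.
have := ej 1 0; rewrite !mxE mulr0n addr0 /= => ej10.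
have := ei 0 0; rewrite !mxE mulr1n /= => ei00.
have := ei 0 1; rewrite !mxE mulr0n addr0 /= => ei01.
have := ej 1 1; rewrite !mxE mulr1n /= => ej11.
have := ep 1 0; rewrite !mxE mulr0n addr0 /= => ep10.
have := ep 0 0; rewrite !mxE !mulr1n /= => ep00.
move: ei10 ej10 ei00 ei01 ej11 ep10 ep00.
move: (erefl t); rewrite {2}/t /trace2.
set c := X 1 0; set a := X 0 0; set d := X 1 1; set b := X 0 1.
move=> def_t ei10 ej10 ei00 ei01 ej11 ep10 ep00.
have c_unit : c * lucas s t i.+1 = 1 by rewrite mulrC.
have eq_f : lucas s t j.+1 = lucas s t i.+1.
  by apply: (unit_cancel c_unit); rewrite ei10 ej10.
rewrite eq_f in ej11.
have f_ij : lucas s t (i.+1 + j.+1) = 0.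
  by apply: (unit_cancel c_unit); rewrite addSn ep10 mul0r.
have def_p : p = s * lucas s t (i + j.+1).
  by move: ep00; rewrite -addSn f_ij mul0r add0r.
have def_a : a = - (c * s * lucas s t i).
  apply: (unit_cancel ei10); rewrite mulrC (canRL (addrK _) ei00).
  transitivity (- (s * lucas s t i) * (c * lucas s t i.+1)); last by ring.
  by rewrite c_unit; ring.
have def_d : d = - (c * s * lucas s t j).
  apply: (unit_cancel ei10); rewrite mulrC (canRL (addrK _) ej11).
  transitivity (- (s * lucas s t j) * (c * lucas s t i.+1)); last by ring.
  by rewrite c_unit; ring.
have f_sum : t * lucas s t i.+1 = - (s * (lucas s t i + lucas s t j)).
  rewrite [X in X * _]def_t def_a def_d.
  transitivity (- (s * (lucas s t i + lucas s t j)) * (c * lucas s t i.+1)).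
    by ring.
  by rewrite c_unit mulr1.
have f_ij1 : lucas s t (i + j.+1)
    = lucas s t i.+1 ^+ 2 + s * lucas s t i * lucas s t j.
  by rewrite addnS lucas_add eq_f expr2.
(* Cassini's identity at j, where f(j+1) = - s f(i-1); below, the same at i. *)
have cassini_j : (- s) ^+ j = lucas s t (i + j.+1).
  have := lucas_docagne s t 1 j; rewrite !add1n mul1r => ->.
  by rewrite lucasSS eq_f f_sum f_ij1; ring.
have cassini_i : (- s) ^+ i = lucas s t (i + j.+1).
  have := lucas_docagne s t 1 i; rewrite !add1n mul1r => ->.
  by rewrite lucasSS f_sum f_ij1; ring.
split=> //.
  split=> //=; rewrite subSS.
  move: le_ji; rewrite leq_eqVlt => /orP[/eqP [->]|lt_ji].
    by rewrite subnn.
  have [q pq1] := p_unit lt_ji.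
  have s_unit : (- s) ^+ j * (s * q) = 1.
    by rewrite cassini_j -pq1 def_p; ring.
  apply: (unit_cancel s_unit); rewrite -exprD subnK; last exact: ltnW lt_ji.
  by rewrite mul1r cassini_i cassini_j.
apply: matrix2P; rewrite !mx2E //= /lucas_p addSn -def_p.
apply: (unit_cancel ei10); rewrite mulrC ei01.
transitivity (p * (c * lucas s t i.+1)); last by ring.
by rewrite c_unit mulr1.
Qed.

End LucasMatrices.

(** * Splitting the noncommutative ring *)

(** Below, [a] and [b] stand for x^i and x^j. *)
Section Splitting.
Variables (R : pzRingType) (a b y : R).
Hypothesis ab_comm : a * b = b * a.
Hypothesis ay_yb : a * y + y * b = 1.
Hypothesis yy : y * y = 0.

Lemma split_yay : y * a * y = y.
Proof. by rewrite -[RHS]mulr1 -ay_yb mulrDr !mulrA yy mul0r addr0. Qed.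

Lemma split_yby : y * b * y = y.
Proof. by rewrite -[RHS]mul1r -ay_yb mulrDl -(mulrA a) yy mulr0 add0r. Qed.

(** Insert 1 = a y + y b between [c] and [d]. *)
Lemma split_insert c d :
  y * c * d * y = y * c * a * (y * d * y) + (y * c * y) * b * d * y.
Proof. by rewrite -{1}[y * c]mulr1 -ay_yb mulrDr !mulrDl !mulrA. Qed.

(** Splitting y b a y in the middle gives y b a y twice, so it vanishes. *)
Lemma split_ybay : y * b * a * y = 0.
Proof.
have := split_insert b a; rewrite split_yay split_yby => /eqP.
by rewrite -subr_eq0 opprD addrA subrr sub0r oppr_eq0 => /eqP.
Qed.

(** The element of [split_ybay] is also y a b y, and splitting this one in the
    middle gives the two squares. *)
Lemma split_squares : y * a * a * y + y * b * b * y = 0.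
Proof.
have := split_insert a b; rewrite split_yay split_yby -(mulrA y a b) ab_comm.
by rewrite mulrA split_ybay => <-.
Qed.

(** Multiplied on the right by 1 = a y + y b, the left-hand side becomes
    b y + y a a y + y b, so the claim is that b y + y a a y = a y; this is where
    [split_ybay] and [split_squares] enter. *)
Lemma split_sym : b * y + y * a = 1.
Proof.
have E c d : y * d * y = y -> c * y * d * y = c * y.
  by move=> ydy; rewrite -!(mulrA c) ydy.
(* Multiply b y - a y on the left by 1 = a y + y b. *)
have D : b * y + y * a * a * y = a * y.
  apply/eqP; rewrite -subr_eq0 addrAC -[b * y - a * y]mul1r -ay_yb.
  rewrite mulrDl !mulrBr !mulrA !(E a) ?split_yay ?split_yby // subrr add0r.
  by rewrite split_ybay subr0 addrC split_squares.
rewrite -[LHS]mulr1 -ay_yb mulrDr !mulrDl !mulrA (E b) ?split_yay //.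
by rewrite -(mulrA b y y) yy mulr0 mul0r add0r D.
Qed.

Lemma split_comm_prod : a * b * y = y * (a * b).
Proof.
have -> : a * b * y = a * (1 - y * a) by rewrite -split_sym addrK mulrA.
rewrite mulrBr mulr1 mulrA -[a in a - _]mul1r -mulrBl.
by rewrite -ay_yb [a * y + _]addrC addrK ab_comm mulrA.
Qed.

Lemma split_comm_diff : (b - a) * y = y * (b - a).
Proof.
apply/eqP; rewrite mulrBl mulrBr subr_eq addrAC -subr_eq opprK.
by rewrite split_sym addrC ay_yb.
Qed.

(** The matrix units E00 = y b, E01 = y, E10 = a y b and E11 = a y, all of the
    form l y r, so that their products reduce to the four products y r l y. *)
Definition split_unit (k l : 'I_2) : R :=
  (if k == 0 then 1 else a) * y * (if l == 0 then b else 1).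

Lemma split_unitE :
  (split_unit 0 0 = y * b) * (split_unit 0 1 = y) *
  (split_unit 1 0 = a * y * b) * (split_unit 1 1 = a * y).
Proof. by rewrite /split_unit /= !(mul1r, mulr1). Qed.

Lemma split_unitM k l m n :
  split_unit k l * split_unit m n = split_unit k n *+ (l == m).
Proof.
rewrite /split_unit; set A := if k == 0 then _ else _.
set B := if n == 0 then _ else _.
transitivity (A * (y * (if l == 0 then b else 1)
                     * (if m == 0 then 1 else a) * y) * B).
  by rewrite !mulrA.
suff -> : y * (if l == 0 then b else 1) * (if m == 0 then 1 else a) * y
    = y *+ (l == m) by rewrite mulrnAr mulrnAl.
move: l m; do 2!apply: ord2P => /=; rewrite ?mulr1 //.
- exact: split_yby.
- exact: split_ybay.
- exact: split_yay.
Qed.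

Lemma split_unit1 : \sum_k split_unit k k = 1.
Proof. by rewrite sum2 /split_unit /= mul1r mulr1 addrC. Qed.


End Splitting.

Lemma center_inv (R : pzRingType) (p : center R) (r : R) :
  val p * r = 1 -> exists q : center R, p * q = 1 /\ val q = r.
Proof.
move=> pr; have rp : r * val p = 1 by rewrite -center_comm.
have cr : r \in @central R.
  apply/centralP => z.
  by rewrite -[r * z]mulr1 -pr -mulrA (mulrA z) -center_comm !mulrA rp mul1r.
by exists (Center cr); split=> //; apply: val_inj; rewrite rmorphM.
Qed.

(** If u and p are comaximal, so are u^n and p: expand the factor 1 in
    1 = u * 1 * a + p b by the equation obtained for the previous power. *)
Lemma comaximal_exp (R : pzRingType) (u p a b : R) n :
    (forall z, p * z = z * p) -> 1 = u * a + p * b ->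
  exists a' b', 1 = u ^+ n * a' + p * b'.
Proof.
move=> p_comm ab; elim: n => [|n [a' [b' IHn]]].
  by exists 1, 0; rewrite expr0 mulr1 mulr0 addr0.
exists (a' * a), (u * b' * a + b); rewrite [LHS]ab.
rewrite -{1}[u]mulr1 {1}IHn exprS !mulrDr !mulrDl addrA -!mulrA.
by rewrite (mulrA u p) -p_comm -!mulrA.
Qed.

Section Noncommutative.
Variables (R : pzRingType) (x y : R) (i j : nat).
Hypothesis j_gt0 : (1 <= j)%N.
Hypothesis le_ji : (j <= i)%N.
Hypothesis co_ij : gcdn i j = 1%N.
Hypothesis rel_xy : x ^+ i * y + y * x ^+ j = 1.
Hypothesis yy : y * y = 0.
Hypothesis gen_xy :
  forall z, z * x = x * z -> z * y = y * z -> z \in @central R.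

Let xij : x ^+ i * x ^+ j = x ^+ j * x ^+ i.
Proof. by rewrite -!exprD addnC. Qed.

Lemma prod_central : x ^+ (i + j) \in @central R.
Proof.
apply: gen_xy; first by rewrite -exprS -exprSr.
by rewrite exprD; exact: split_comm_prod.
Qed.

Lemma diff_central : x ^+ j - x ^+ i \in @central R.
Proof.
apply: gen_xy; first by rewrite mulrBl mulrBr -!exprS -!exprSr.
exact: split_comm_diff.
Qed.

(* The scalars of [power_i] and [power_j]. *)
Let p : center R := Center prod_central.
Let u : center R := Center diff_central.

(** With d = i - j > 0 we have u = x^j (1 - x^d).  On the one hand
    x^j - x^(j + d i) = x^j (1 - x^(d i)) is a multiple of u and p divides
    x^(j + d i), so x^j = u S + p W; then y x^j y = y puts 1 in the ideal
    (u, p).  On the other hand a high power of u is divisible by a high power of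
    x, hence by p. *)
Lemma prod_unit : (j < i)%N -> exists q : center R, p * q = 1.
Proof.
move=> lt_ji; pose d := (i - j)%N.
have def_i : i = (j + d)%N by rewrite subnKC.
have def_u : val u = x ^+ j * (1 - x ^+ d).
  by rewrite mulrBr mulr1 -exprD -def_i.
have [S [W xj]] : exists S W, x ^+ j = val u * S + val p * W.
  exists (\sum_(l < i) x ^+ d ^+ l), (x ^+ (d * i - i)).
  have le_i : (i <= d * i)%N by rewrite leq_pmull // subn_gt0.
  rewrite def_u -mulrA -[1 - _]opprB mulNr -subrX1 opprB mulrBr mulr1.
  by rewrite -exprM -!exprD addnAC subnKC // [(d * i + j)%N]addnC addrNK.
have [V uV] : exists V, val u ^+ (i + j) = val p * V.
  exists (x ^+ (j.-1 * (i + j)) * (1 - x ^+ d) ^+ (i + j)).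
  rewrite def_u exprMn_comm; last first.
    by rewrite /GRing.comm mulrBr mulrBl mulr1 mul1r -!exprD addnC.
  by rewrite mulrA -exprM -exprD -mulSn prednK.
(* [T] is linear over the center and maps x^j to x^i y + y x^j = 1. *)
have [a [b ab]] : exists a b, 1 = val u * a + val p * b.
  pose T Z := x ^+ i * (y * Z * y) + (y * Z * y) * x ^+ j.
  have TD Z Z' : T (Z + Z') = T Z + T Z'.
    by rewrite /T mulrDr !mulrDl mulrDr addrACA.
  have TM (r : center R) Z : T (val r * Z) = val r * T Z.
    by rewrite /T !mulrA -!(center_comm r) -!mulrA -mulrDr.
  by exists (T S), (T W); rewrite -!TM -TD -xj /T (split_yby rel_xy yy) rel_xy.
have [a' [b' ab']] : exists a' b', 1 = val u ^+ (i + j) * a' + val p * b'.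
  exact: comaximal_exp (center_comm p) ab.
have [|q [pq _]] := @center_inv R p (V * a' + b'); last by exists q.
by rewrite mulrDr mulrA -uV.
Qed.

(** If i k = (i + j) n + 1 then (x^i)^k = p^n x, and p is invertible unless
    i = j = 1, where k = 1 and n = 0 work.  So x is a central multiple of a
    power of x^i, which is the matrix [power_i p u] over the center.  The powers
    of the resulting matrix are known because [F] is injective. *)
Lemma center_splitting :
  exists (F : {rmorphism 'M[center R]_2 -> R}) (X : 'M[center R]_2)
         (p u : center R),
    [/\ forall Y, F Y = \sum_k \sum_l val (Y k l)
                            * split_unit (x ^+ i) (x ^+ j) y k l,
        forall z, F z%:M = val z
      & [/\ F X = x, X ^+ i = power_i p u, X ^+ j = power_j p u
      & (j < i)%N -> exists q, p * q = 1]].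
Proof.
have [F [FE FZ F_inj]] := mx_lift (h := val : {rmorphism center R -> R})
  (@center_comm R) (split_unitM rel_xy yy) (split_unit1 rel_xy).
have {}F_inj : injective F by apply: F_inj; exact: val_inj.
have Fi : F (power_i p u) = x ^+ i.
  rewrite FE !sum2 /power_i !mx2E !split_unitE rmorph0 rmorph1 rmorphN.
  rewrite mul0r mul1r add0r.
  rewrite /= exprD mulNr mulrBl opprB addrCA [_ + (_ - _)]addrC.
  rewrite xij -(mulrA (x ^+ j)) subrK -mulrA -mulrDr [_ + x ^+ i * y]addrC.
  by rewrite rel_xy mulr1.
have Fj : F (power_j p u) = x ^+ j.
  have -> : power_j p u = power_i p u + u%:M.
    by apply: matrix2P; rewrite !mxE ?(mulr0n, mulr1n) /=; ring.
  by rewrite rmorphD Fi FZ /= addrC subrK.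
have [k [q xq]] : exists k (q : center R), val q * x ^+ (i * k) = x.
  have i_gt0 := leq_trans j_gt0 le_ji.
  have [eq_ij|neq_ij] := eqVneq i j.
    exists 1, 1; rewrite muln1 rmorph1 mul1r; move: co_ij.
    by rewrite -eq_ij gcdnn => ->.
  have [q pq] : exists q : center R, p * q = 1.
    by apply: prod_unit; rewrite ltn_neqAle eq_sym neq_ij.
  have [k n def_k _] := egcdnP (i + j) i_gt0.
  exists k, (q ^+ n); rewrite mulnC def_k gcdnDl co_ij exprD mulrA.
  rewrite [(n * _)%N]mulnC exprM.
  have -> : (x ^+ (i + j)) ^+ n = val (p ^+ n) by rewrite rmorphXn.
  by rewrite -rmorphM -exprMn [q * p]mulrC pq expr1n rmorph1 mul1r.
exists F, (q%:M * power_i p u ^+ k), p, u.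
have FX : F (q%:M * power_i p u ^+ k) = x.
  by rewrite rmorphM rmorphXn FZ Fi -exprM.
do 2!split=> //; last exact: prod_unit.
- by apply: F_inj; rewrite rmorphXn FX Fi.
- by apply: F_inj; rewrite rmorphXn FX Fj.
Qed.

End Noncommutative.

(** * The isomorphism *)

Lemma free_comm (A S : pzRingType) (I : choiceType) (r : S)
    (F : {rmorphism monalg A {fmonom I} -> S}) :
    (forall a, r * F (monalgC _ a) = F (monalgC _ a) * r) ->
    (forall i, r * F (monalgX A (fmu i)) = F (monalgX A (fmu i)) * r) ->
  forall g, r * F g = F g * r.
Proof.
move=> rC rX g.
have rXk k : r * F (monalgX A k) = F (monalgX A k) * r.
  elim/fmonom_ind: k => [|i m IHm].
    by rewrite monalgX1 rmorph1 mulr1 mul1r.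
  by rewrite monalgXM rmorphM mulrA rX -mulrA IHm mulrA.
rewrite (monalg_sum g) raddf_sum mulr_sumr mulr_suml; apply: eq_bigr => k _ /=.
by rewrite rmorphM mulrA rC -mulrA rXk mulrA.
Qed.

Lemma monalgC_comm (A : comPzRingType) (I : choiceType) (a : A)
    (g : monalg A {fmonom I}) : monalgC _ a * g = g * monalgC _ a.
Proof.
apply: (@free_comm A _ I _ idfun) => [b|i].
  rewrite -[LHS](rmorphM (@monalgC A _)) -[RHS](rmorphM (@monalgC A _)).
  congr (monalgC _ _).
  exact: mulrC.
rewrite /GRing.mul /= !monalg_mulUU mulr1 mul1r mul1m.
by rewrite mulm1.
Qed.

Definition ideal_rel (K : comPzRingType) (s t : K) (i j : nat) : Prop :=
  [/\ lucas s t (i + j) = 0, lucas s t (i + j).-1 = s ^+ j.-1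
    & s ^+ (i - j) = (-1) ^+ (i - j)].

Section Relations.
Variables (A : comPzRingType) (i j : nat).

Local Notation R := (Rij11 A i j).
Local Notation Q := (poly2_mod_I A i j).

Definition R_x : R := quot_pi _ (monalgX A (fmu ord0)).
Definition R_y : R := quot_pi _ (monalgX A (fmu ord_max)).
Definition Q_s : Q := quot_pi _ (monalgX A (ucm ord0)).
Definition Q_t : Q := quot_pi _ (monalgX A (ucm ord_max)).

Lemma quot_gen0 (P : pzRingType) (gs : seq P) g : g \in gs -> quot_pi gs g = 0.
Proof.
move=> gs_g; rewrite -(rmorph0 (quot_pi gs)); apply/eqP.
by rewrite quot_piE subr0; apply/ideal_genP => J _; apply.
Qed.

Lemma R_rel1 : R_x ^+ i * R_y + R_y * R_x ^+ j = 1.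
Proof.
apply/eqP; rewrite -subr_eq0 /R_x /R_y -!rmorphXn -!rmorphM -rmorphD.
rewrite -(rmorph1 (quot_pi (R_rels A i j))) -rmorphB.
by apply/eqP/quot_gen0; rewrite mem_head.
Qed.

Lemma R_rel2 : R_y * R_y = 0.
Proof.
by rewrite -rmorphM; apply: quot_gen0; rewrite !inE -expr2 eqxx orbT.
Qed.

Lemma R_scalar_central (a : A) (z : R) :
  quotC (R_rels A i j) a * z = z * quotC (R_rels A i j) a.
Proof.
by rewrite -[z]quot_reprK /quotC -!rmorphM monalgC_comm.
Qed.

Lemma ord2_cases (k : 'I_2) : k = ord0 \/ k = ord_max.
Proof. by case: k => [[|[|k]] ltk] //; [left | right]; apply: val_inj. Qed.

Lemma R_gen (z : R) :
  z * R_x = R_x * z -> z * R_y = R_y * z -> z \in @central R.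
Proof.
move=> zx zy; apply/centralP => w; rewrite -[w]quot_reprK.
apply: (@free_comm A R 'I_2 z (quot_pi (R_rels A i j))) => [a|k].
  exact/esym/R_scalar_central.
by case: (ord2_cases k) => ->; [exact: zx | exact: zy].
Qed.

Lemma R_lift (S : pzRingType) (f : {rmorphism A -> S}) (x y : S) :
    (forall a r, f a * r = r * f a) ->
    x ^+ i * y + y * x ^+ j = 1 -> y * y = 0 ->
  exists F : {rmorphism R -> S},
    [/\ forall a, F (quotC _ a) = f a, F R_x = x & F R_y = y].
Proof.
move=> fC rel yy.
pose v (k : 'I_2) := if k == ord0 then x else y.
have [F [FC FX]] := @free_lift A S _ f v (fun a k => fC a (v k)).
have Fx := FX ord0; have Fy := FX ord_max; rewrite /= in Fx Fy.
have F_rels (P : pzRingType) (G : {rmorphism P -> S}) (a b : P) :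
    G a = x -> G b = y ->
  {in [:: a ^+ i * b + b * a ^+ j - 1; b ^+ 2], forall g, G g = 0}.
  move=> Ga Gb g; rewrite !inE => /orP[] /eqP ->.
    by rewrite rmorphB rmorphD !rmorphM !rmorphXn rmorph1 Ga Gb rel subrr.
  by rewrite rmorphXn Gb expr2.
have [G GE] := quot_lift (F_rels _ F _ _ Fx Fy : {in R_rels A i j, _}).
exists G; split=> [a||].
- exact: etrans (GE _) (FC a).
- exact: etrans (GE _) Fx.
- exact: etrans (GE _) Fy.
Qed.

Lemma R_ext (S : pzRingType) (F G : {rmorphism R -> S}) :
    (forall a, F (quotC _ a) = G (quotC _ a)) ->
  F R_x = G R_x -> F R_y = G R_y -> F =1 G.
Proof.
move=> eqC eqx eqy z; rewrite -[z]quot_reprK.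
apply: (@free_ext A S 'I_2 (F \o quot_pi _) (G \o quot_pi _) eqC) => k.
by case: (ord2_cases k) => ->; [exact: eqx | exact: eqy].
Qed.

Lemma Q_lift (S : comPzRingType) (f : {rmorphism A -> S}) (s t : S) :
    ideal_rel s t i j ->
  exists F : {rmorphism Q -> S},
    [/\ forall a, F (quotC _ a) = f a, F Q_s = s & F Q_t = t].
Proof.
move=> [rel1 rel2 rel3].
have [F [FC FX]] := poly_lift f (fun k : 'I_2 => if k == ord0 then s else t).
have Fs := FX ord0; have Ft := FX ord_max; rewrite /= in Fs Ft.
have F_gens (P : comPzRingType) (G : {rmorphism P -> S}) (a b : P) :
    G a = s -> G b = t ->
  {in [:: lucas a b (i + j); lucas a b (i + j - 1) - a ^+ (j - 1);
          a ^+ (i - j) - (-1) ^+ (i - j)], forall g, G g = 0}.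
  move=> Ga Gb g; rewrite !inE !subn1 => /or3P[] /eqP ->.
  - by rewrite rmorph_lucas Ga Gb.
  - by rewrite rmorphB rmorphXn rmorph_lucas Ga Gb rel2 subrr.
  - by rewrite rmorphB !rmorphXn rmorphN1 Ga rel3 subrr.
have [G GE] := quot_lift (F_gens _ F _ _ Fs Ft : {in I_gens A i j, _}).
exists G; split=> [a||].
- exact: etrans (GE _) (FC a).
- exact: etrans (GE _) Fs.
- exact: etrans (GE _) Ft.
Qed.

Lemma Q_ext (S : pzRingType) (F G : {rmorphism Q -> S}) :
    (forall a, F (quotC _ a) = G (quotC _ a)) ->
  F Q_s = G Q_s -> F Q_t = G Q_t -> F =1 G.
Proof.
move=> eqC eqs eqt z; rewrite -[z]quot_reprK.
apply: (@poly_ext A S 'I_2 (F \o quot_pi _) (G \o quot_pi _) eqC) => k.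
by case: (ord2_cases k) => ->; [exact: eqs | exact: eqt].
Qed.

Lemma Q_rel1 : lucas Q_s Q_t (i + j) = 0.
Proof.
rewrite -(rmorph_lucas (quot_pi (I_gens A i j))).
by apply: quot_gen0; rewrite mem_head.
Qed.

Lemma Q_rel2 : lucas Q_s Q_t (i + j).-1 = Q_s ^+ j.-1.
Proof.
apply/eqP; rewrite -subr_eq0 -rmorphXn.
rewrite -(rmorph_lucas (quot_pi (I_gens A i j))).
rewrite -rmorphB -!subn1; apply/eqP/quot_gen0.
by rewrite !inE eqxx orbT.
Qed.

Lemma Q_rel3 : Q_s ^+ (i - j) = (-1) ^+ (i - j).
Proof.
apply/eqP; rewrite -subr_eq0 -rmorphXn -(rmorph_sign (quot_pi (I_gens A i j))).
by rewrite -rmorphB; apply/eqP/quot_gen0; rewrite !inE eqxx !orbT.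
Qed.

Lemma Q_rel : ideal_rel Q_s Q_t i j.
Proof. by split; [exact: Q_rel1 | exact: Q_rel2 | exact: Q_rel3]. Qed.

End Relations.

(** Put e = (-1)^(j-1).  Replacing t by e t multiplies f(n) by e^(n-1), and
    e^(i+j-1) = 1 because i and j are not both even. *)
Lemma lucas_rel_sign (K : comPzRingType) (s t : K) (i j : nat) :
    (1 <= j)%N -> (j <= i)%N -> gcdn i j = 1%N ->
  lucas_rel s ((-1) ^+ j.-1 * t) i j <->
  ideal_rel s t i j.
Proof.
case: j => // j _; case: i => // i _ co_ij.
rewrite /lucas_rel /ideal_rel succnK.
set e : K := (-1) ^+ j.
have e2 : e ^+ 2 = 1 by rewrite /e -exprM mulnC exprM sqrrN !expr1n.
have e_odd : e ^+ (i + j).+1 = 1.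
  rewrite /e -exprM -signr_odd oddM /= oddD.
  suff /negbTE -> : ~~ (odd j && ~~ (odd i (+) odd j)) by [].
  apply/negP => /andP[odd_j]; rewrite odd_j addbT negbK => odd_i.
  have : (2 %| gcdn i.+1 j.+1)%N by rewrite dvdn_gcd !dvdn2 /= odd_i odd_j.
  by rewrite co_ij.
have e_ij : e ^+ (i + j) = e.
  by rewrite -[LHS]mul1r -e2 expr2 -mulrA -exprS e_odd mulr1.
have eK (a b : K) : (e * a = e * b) <-> (a = b).
  split=> [eab|-> //]; rewrite -[a]mul1r -[b]mul1r -e2 expr2 -!mulrA.
  by rewrite eab.
rewrite addSn addnS !succnK !lucas_scale // e_odd e_ij mul1r (exprNn s j) -/e.
have sign_d : (- s) ^+ (i.+1 - j.+1) = 1 <->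
    s ^+ (i.+1 - j.+1) = (-1) ^+ (i.+1 - j.+1).
  set d := (_ - _)%N; rewrite (exprNn s d).
  have d2 : (-1) ^+ d * (-1) ^+ d = 1 :> K by rewrite -expr2 sqrr_sign.
  split=> [sd|->]; last exact: d2.
  by rewrite -[LHS]mul1r -{1}d2 -mulrA sd mulr1.
by split=> -[? /eK ? /sign_d ?]; split=> //; apply/eK.
Qed.

(** The off-diagonal matrix units generate the others, so it suffices to commute
    with these two. *)
Lemma scalar_matrix2 (K : comPzRingType) (N : 'M[K]_2) :
    N * mx2 0 1 0 0 = mx2 0 1 0 0 * N -> N * mx2 0 0 1 0 = mx2 0 0 1 0 * N ->
  N = (N 0 0)%:M.
Proof.
have simp := (mulr0, mulr1, mul0r, mul1r, add0r, addr0).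
move=> /matrixP c01 /matrixP c10; apply: matrix2P; rewrite !mxE //=.
- by have := c10 0 0; rewrite !mul2E !mx2E /= !simp.
- by have := c01 0 0; rewrite !mul2E !mx2E /= !simp.
- by have := c01 0 1; rewrite !mul2E !mx2E /= !simp.
Qed.

Lemma scalar_comm (K : comPzRingType) (n : nat) (a : K) (N : 'M[K]_n) :
  a%:M * N = N * a%:M.
Proof. exact: esym (scalar_mxC _ _). Qed.

Lemma split_unit_powers (K : comPzRingType) (p u : K) k l :
  split_unit (power_i p u) (power_j p u) (mx2 0 1 0 0) k l = delta_mx k l.
Proof.
move: k l; do 2!apply: ord2P; rewrite split_unitE.
all: by apply: matrix2P; rewrite !(mul2E, mx2E) !mxE /=; ring.
Qed.

(** The two rings enter through their universal properties, for the equations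
    in x and y and for those in s and t. *)
Section Isomorphism.
Variables (A R : pzRingType) (Q : comPzRingType) (i j : nat).
Variables (cR : {rmorphism A -> R}) (x y : R).
Variables (cQ : {rmorphism A -> Q}) (s0 t0 : Q).
Hypotheses (j_gt0 : (1 <= j)%N) (le_ji : (j <= i)%N).
Hypothesis co_ij : gcdn i j = 1%N.
Hypothesis cR_central : forall a r, cR a * r = r * cR a.
Hypothesis rel_xy : x ^+ i * y + y * x ^+ j = 1.
Hypothesis yy : y * y = 0.
Hypothesis gen_xy :
  forall z, z * x = x * z -> z * y = y * z -> z \in @central R.
Hypothesis lift_xy :
  forall (S : pzRingType) (f : {rmorphism A -> S}) (x' y' : S),
    (forall a r, f a * r = r * f a) ->
    x' ^+ i * y' + y' * x' ^+ j = 1 -> y' * y' = 0 ->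
  exists F : {rmorphism R -> S},
    [/\ forall a, F (cR a) = f a, F x = x' & F y = y'].
Hypothesis ext_xy : forall (S : pzRingType) (F G : {rmorphism R -> S}),
    (forall a, F (cR a) = G (cR a)) -> F x = G x -> F y = G y -> F =1 G.
Hypothesis rel_st : ideal_rel s0 t0 i j.
Hypothesis lift_st :
  forall (S : comPzRingType) (f : {rmorphism A -> S}) (s t : S),
    ideal_rel s t i j ->
  exists F : {rmorphism Q -> S},
    [/\ forall a, F (cQ a) = f a, F s0 = s & F t0 = t].
Hypothesis ext_st : forall (S : pzRingType) (F G : {rmorphism Q -> S}),
    (forall a, F (cQ a) = G (cQ a)) -> F s0 = G s0 -> F t0 = G t0 -> F =1 G.

Let scalar_central a : cR a \in @central R.
Proof. exact/centralP/cR_central. Qed.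

Definition center_scalar (a : A) : center R := Center (scalar_central a).

Lemma center_scalar_is_zmod_morphism : zmod_morphism center_scalar.
Proof.
by move=> a b; apply: val_inj; rewrite [RHS]rmorphB /= rmorphB.
Qed.

Lemma center_scalar_is_monoid_morphism : monoid_morphism center_scalar.
Proof.
split=> [|a b]; apply: val_inj; first by rewrite [RHS]rmorph1 /= rmorph1.
by rewrite [RHS]rmorphM /= rmorphM.
Qed.

HB.instance Definition _ := GRing.isZmodMorphism.Build _ _ center_scalar
  center_scalar_is_zmod_morphism.
HB.instance Definition _ := GRing.isMonoidMorphism.Build _ _ center_scalar
  center_scalar_is_monoid_morphism.

Lemma matrix_iso : exists phi : {rmorphism R -> 'M[Q]_2},
  bijective phi /\ forall a, phi (cR a) = (cQ a)%:M.
Proof.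
have i_gt0 := leq_trans j_gt0 le_ji.
pose e (K : comPzRingType) : K := (-1) ^+ j.-1.
have e2 K : e K * e K = 1 by rewrite -expr2 sqrr_sign.
have [F [X [p [u [FE FZ [FX Xi Xj p_unit]]]]]] :=
  center_splitting j_gt0 le_ji co_ij rel_xy yy gen_xy.
set s := normN2 X; set t := trace2 X.
have [relX unit_X def_X] := powers_lucas_mx j_gt0 le_ji p_unit Xi Xj.
rewrite -/s -/t in relX unit_X def_X.
set tQ := e _ * t0.
have rel_Q : lucas_rel s0 tQ i j.
  exact: (lucas_rel_sign s0 t0 j_gt0 le_ji co_ij).2.
have [eq_fQ [c unit_c]] := lucas_rel_unit j_gt0 le_ji co_ij rel_Q.
have [fQ_ij _ _] := rel_Q.
have [trXQ nXQ] := lucas_mx_powers j_gt0 i_gt0 eq_fQ unit_c fQ_ij.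
set XQ := lucas_mx _ _ _ _ _ => XQi XQj.
have [g [gC gs gt]] : exists g : {rmorphism Q -> center R},
    [/\ forall a, g (cQ a) = center_scalar a, g s0 = s & g tQ = t].
  have := (lucas_rel_sign s (e _ * t) j_gt0 le_ji co_ij).1.
  rewrite -/(e _) mulrA e2 mul1r => /(_ relX) rel.
  have [g [gC gs gt]] := lift_st center_scalar rel.
  exists g; split=> //.
  by rewrite rmorphM rmorph_sign gt mulrA e2 mul1r.
have [phi [phiC phi_x phi_y]] : exists phi : {rmorphism R -> 'M[Q]_2},
    [/\ forall a, phi (cR a) = (cQ a)%:M,
        phi x = XQ & phi y = mx2 0 1 0 0].
  apply: (lift_xy (f := @scalar_mx Q 2 \o cQ)) => [a M||].
  - exact: scalar_comm.
  - rewrite XQi XQj; apply: matrix2P; rewrite !mxE !sum2 !mxE /=; ring.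
  - apply: matrix2P; rewrite !mul2E !mxE /=; ring.
have gX : map_mx g XQ = X.
  have gc : g c = X 1 0.
    apply: (unit_cancel unit_X); rewrite [RHS]mulrC unit_X.
    by rewrite -(rmorph1 g) -unit_c rmorphM rmorph_lucas gs gt mulrC.
  rewrite def_X; apply: matrix2P; rewrite !mxE /= ?rmorphN ?rmorphM gc //.
  - by rewrite rmorph_lucas gs gt.
  - by rewrite rmorph_lucas gs gt.
  - by rewrite rmorph_lucas gs gt.
pose psi (M : 'M[Q]_2) : R := F (map_mx g M).
(* The images of the matrix units of R are the standard ones, so the image of
   a central element commutes with these and is scalar; in particular the
   entries of X are mapped to the entries of XQ. *)
have phi_unit k l : phi (split_unit (x ^+ i) (x ^+ j) y k l) = delta_mx k l.
  rewrite -(split_unit_powers (lucas_p s0 tQ i j) (lucas_u s0 tQ i j)).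
  rewrite -XQi -XQj /split_unit !rmorphM.
  by do 2!case: ifP => _; rewrite ?rmorph1 ?rmorphXn ?phi_x phi_y.
have phi_center (z : center R) : phi (val z) = (phi (val z) 0 0)%:M.
  apply: scalar_matrix2; first by rewrite -phi_y -!rmorphM center_comm.
  have -> : mx2 0 0 1 0 = delta_mx 1 0 :> 'M[Q]_2.
    by apply: matrix2P; rewrite !mxE.
  by rewrite -phi_unit -!rmorphM center_comm.
have phi_X k l : phi (val (X k l)) = (XQ k l)%:M.
  suff -> : XQ = \matrix_(k, l) phi (val (X k l)) 0 0.
    by rewrite mxE phi_center mxE.
  rewrite -phi_x -[x]FX FE rmorph_sum [RHS]matrix_sum_delta.
  apply: eq_bigr => m _; rewrite rmorph_sum; apply: eq_bigr => n _.
  by rewrite rmorphM phi_unit phi_center [LHS]mul_scalar_mx !mxE.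
have phi_s : phi (val s) = s0%:M.
  transitivity (phi (val (X 0 1)) * phi (val (X 1 0))
                - phi (val (X 0 0)) * phi (val (X 1 1))).
    by rewrite -!rmorphM -!rmorphB.
  by rewrite !phi_X -!rmorphM -rmorphB -[in RHS]nXQ.
have phi_t : phi (val t) = tQ%:M.
  transitivity (phi (val (X 0 0)) + phi (val (X 1 1))).
    by rewrite -!rmorphD.
  by rewrite !phi_X -rmorphD -[in RHS]trXQ.
have phi_g q : phi (val (g q)) = q%:M.
  apply: (@ext_st _ (phi \o val \o g) (@scalar_mx Q 2)) => [a||] /=.
  - by rewrite gC phiC.
  - by rewrite gs phi_s.
  - have -> : t0 = e _ * tQ by rewrite mulrA e2 mul1r.
    rewrite (rmorphM g) gt rmorphM rmorphM phi_t.
    by rewrite /e !rmorph_sign.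
exists phi; split=> //.
exists psi => [r|M].
  apply: (@ext_xy _ (F \o map_mx g \o phi) idfun) => [a||] /=.
  - by rewrite phiC map_scalar_mx FZ gC.
  - by rewrite phi_x gX FX.
  - rewrite phi_y FE !sum2 !split_unitE !mxE /= !(rmorph0, rmorph1).
    by rewrite !mul0r mul1r add0r !addr0.
rewrite /psi FE rmorph_sum [RHS]matrix_sum_delta; apply: eq_bigr => k _.
rewrite rmorph_sum; apply: eq_bigr => l _.
by rewrite rmorphM phi_unit mxE phi_g [LHS]mul_scalar_mx.
Qed.

End Isomorphism.

Theorem theorem2p16 (A : comPzRingType) (i j : nat)
    (j_gt0 : (1 <= j)%N) (le_ji : (j <= i)%N) (co_ij : gcdn i j = 1%N) :
  exists phi : {rmorphism Rij11 A i j -> 'M[poly2_mod_I A i j]_2},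
    bijective phi /\
    (forall a : A, phi (quotC (R_rels A i j) a) = (quotC (I_gens A i j) a)%:M).
Proof.
apply: (@matrix_iso A (Rij11 A i j) (poly2_mod_I A i j) i j
  (quotC (R_rels A i j)) (R_x A i j) (R_y A i j)
  (quotC (I_gens A i j)) (Q_s A i j) (Q_t A i j) j_gt0 le_ji co_ij).
- exact: R_scalar_central.
- exact: R_rel1.
- exact: R_rel2.
- exact: R_gen.
- exact: R_lift.
- exact: R_ext.
- exact: Q_rel.
- exact: Q_lift.
- exact: Q_ext.
Qed.
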